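(* Let $X$ be a non-empty finite set and let $\Theta=\{1,\dots,N\}$ be a finite set of types with type distribution $\pi\in\Delta(\Theta)$. For each $\theta\in\Theta$ let $V_\theta:\Delta(X)\to\mathbb{R}$ and $F_\theta:\Delta(X)\to\mathbb{R}$ be continuous functions, where $F_\theta(\nu)=\max_{a\in A}E_\nu[u(a,x,\theta)]$. Then for every $\mu\in\Delta(X)$ there exists $(P_1^*,\dots,P_N^* )\in\Delta^2(X)^N$ that solves $$\sup_{(P_\theta)_{\theta\in\Theta}\in\Delta^2(X)^N}\ \sum_{\theta\in\Theta}\pi(\theta)E_{P_\theta}[V_\theta]\quad\text{s.t.}\quad E_{P_\theta}[F_\theta]\ge E_{P_{\theta'}}[F_\theta]\ \ \forall\theta,\theta'\in\Theta,\qquad E_{P_\theta}[\nu]=\mu\ \ \forall\theta\in\Theta,$$ and such that $|\mathrm{supp}(P_i^* )|\le(N+2)\cdot|X|$ for each $i=1,\dots,N$.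
   Context: $\Delta(X)\subset\mathbb{R}^{|X|}$ is the simplex of probability measures on the finite set $X$ (and $\Delta(\Theta)$ likewise), and $\Delta^2(X)$ is the set of all Borel probability measures on $\Delta(X)$. For $P\in\Delta^2(X)$, $E_P[\nu]=\int_{\Delta(X)}\nu\,dP(\nu)$ is the barycenter and $E_P[V]=\int_{\Delta(X)}V(\nu)\,dP(\nu)$; $\mathrm{supp}(P)$ is its support. $A$ is a (possibly infinite) set of actions and $u:A\times X\times\Theta\to\mathbb{R}$ is the receiver's utility, such that the maximum defining $F_\theta$ is attained; $E_\nu[u(a,x,\theta)]=\sum_{x\in X}\nu(x)u(a,x,\theta)$. $V_\theta$ is the sender's utility at each belief when the receiver's type is $\theta$. ''Solves'' means feasible and attaining the supremum. *)

(* Defs.v *)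
From HB Require Import structures.
From mathcomp Require Import all_boot all_order all_algebra.
From mathcomp Require Import all_classical all_reals all_analysis.

Set Implicit Arguments.
Unset Strict Implicit.
Unset Printing Implicit Defensive.

Import Order.TTheory GRing.Theory Num.Theory.
Import numFieldNormedType.Exports.

Local Open Scope classical_set_scope.
Local Open Scope ring_scope.

(* [{ptws X -> R}] is [X -> R] with the product topology;
   since [X] is finite this is the usual topology of R^|X|. *)
Definition simplex (R : realType) (X : finType) : set {ptws X -> R} :=
  [set p | (forall x, 0 <= p x) /\ \sum_(x : X) p x = 1].
Arguments simplex : clear implicits.

Lemma simplex_neq0 (R : realType) (X : finType) :
  (0 < #|X|)%N -> simplex R X !=set0.
Proof.
case/card_gt0P => x0 _; exists (fun x => (x == x0)%:R); split.
  by move=> x; rewrite ler0n.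
by rewrite (bigD1 x0)//= eqxx big1 ?addr0// => x /negPf ->.
Qed.

(* The simplex as a type.  The nonemptiness proof [X0] is only there because
   measurable types of the library must be inhabited. *)
Definition belief (R : realType) (X : finType) (X0 : (0 < #|X|)%N) : Type :=
  set_type (simplex R X).
Arguments belief : clear implicits.

Section belief_structure.
Context (R : realType) (X : finType) (X0 : (0 < #|X|)%N).

Definition belief_val (nu : belief R X X0) : X -> R := set_val nu.

Definition belief_point : belief R X X0 :=
  SigSub (mem_set (svalP (cid (simplex_neq0 R X0)))).

(* Subspace topology, and the Borel sigma-algebra it generates. *)
HB.instance Definition _ :=
  PseudoMetric.copy (belief R X X0) (set_type (simplex R X)).
HB.instance Definition _ := isPointed.Build (belief R X X0) belief_point.
HB.instance Definition _ := Measurable.copy (belief R X X0)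
  (g_sigma_algebraType (@open (belief R X X0))).

End belief_structure.

Coercion belief_val : belief >-> Funclass.

Definition supp (R : realType) (X : finType) (X0 : (0 < #|X|)%N)
    (P : probability (belief R X X0) R) : set (belief R X X0) :=
  [set nu | forall U : set (belief R X X0), open U -> U nu -> (0 < P U)%E].

Definition is_max (R : realType) (S : set R) (m : R) : Prop :=
  S m /\ ubound S m.

Definition solves (R : realType) (T : Type) (C : set T) (J : T -> \bar R)
    (t : T) : Prop :=
  C t /\ J t = ereal_sup [set J s | s in C].

Section persuasion_problem.
Context (R : realType) (X : finType) (X0 : (0 < #|X|)%N) (N : nat).
Local Notation Delta := (belief R X X0).
Local Notation Delta2 := (probability (belief R X X0) R).

Definition exp_utility (A : Type) (u : A -> X -> 'I_N -> R) (i : 'I_N)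
    (nu : Delta) (a : A) : R :=
  \sum_(x : X) nu x * u a x i.

Definition incentive_compatible (F : 'I_N -> Delta -> R)
    (P : 'I_N -> Delta2) : Prop :=
  forall i j : 'I_N, ('E_(P j)[F i] <= 'E_(P i)[F i])%E.

Definition has_barycenter (Q : Delta2) (mu : Delta) : Prop :=
  forall x : X, ('E_Q[fun nu : Delta => nu x] = (mu x)%:E)%E.

Definition feasible (F : 'I_N -> Delta -> R) (mu : Delta) :
    set ('I_N -> Delta2) :=
  [set P | incentive_compatible F P /\ forall i, has_barycenter (P i) mu].

Definition objective (pi : 'I_N -> R) (V : 'I_N -> Delta -> R)
    (P : 'I_N -> Delta2) : \bar R :=
  (\sum_(i < N) (pi i)%:E * 'E_(P i)[V i])%E.

End persuasion_problem.

(* Main.v *)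
Require Import Defs.
From HB Require Import structures.
From mathcomp Require Import all_boot all_order all_algebra.
From mathcomp Require Import all_classical all_reals all_analysis.
From mathcomp Require Import measurable_realfun ring lra.

(** The constraints and the objective see type [i]'s distribution [P i] only
    through finitely many moments: the means of [V i], of the [N] functions
    [F j] and of the [|X|] coordinates.  Moments of probability measures are
    convex combinations of values at single beliefs, and by Caratheodory's
    theorem as many atoms as there are moments, here [N + |X| + 1], are enough;
    one would expect one more, but the coordinates of a belief sum to [1], so
    the total mass is itself a linear function of the moments.  Every feasible
    profile can therefore be replaced, with the same value, by a profile of
    weighted families of [N + |X| + 1] beliefs.  Such profiles form a compact
    space (Tychonoff), feasibility is a closed condition on them and the
    objective is continuous, so the supremum is attained.  Finally
    [N + |X| + 1 <= (N + 2) * |X|] because [|X| >= 1].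

    That the moments of an arbitrary measure are moments of an atomic one
    ([moments_attained], [expectation_mean]) is proved without approximating
    the measure.  The moment vectors of atomic families form a compact set, so
    there is one, [m'], closest to the moment vector [m] of the measure.
    Moving from [m'] a little towards the values at a single belief stays in
    the set, since the extra atom can be removed again ([mean_segment]).
    Minimality then bounds the linear form of direction [m - m'] at every
    belief by its value at [m'].  Integrating this bound gives
    [|m - m'|^2 <= 0]. *)

Set Implicit Arguments.
Unset Strict Implicit.
Unset Printing Implicit Defensive.

Import Order.TTheory GRing.Theory Num.Theory.
Import numFieldNormedType.Exports.

Local Open Scope classical_set_scope.
Local Open Scope card_scope.
Local Open Scope ring_scope.

(** * Caratheodory's reduction *)

Lemma big_option (V : nmodType) (I : finType) (f : option I -> V) :
  \sum_o f o = f None + \sum_k f (Some k).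
Proof.
rewrite (bigD1 None) //=; congr (_ + _).
rewrite (reindex_omap Some id) /=; last by case.
by apply: eq_bigl => k; rewrite eqxx.
Qed.

(** Enumerates [option I] without the point [j], so that a family indexed by
    [option I] from which one term was removed is again indexed by [I]. *)
Definition avoid (I : eqType) (j : option I) (k : I) : option I :=
  if Some k == j then None else Some k.

Lemma sum_avoid (V : nmodType) (I : finType) (j : option I)
    (f : option I -> V) :
  f j = 0 -> \sum_k f (avoid j k) = \sum_o f o.
Proof.
move=> fj; rewrite big_option; case: j fj => [k0|] fj /=; last first.
  by rewrite fj add0r; apply: eq_bigr.
rewrite (bigD1 k0) //= [in RHS](bigD1 k0) //= fj add0r /avoid eqxx.
congr (_ + _); apply: eq_bigr => k /negPf kk0.
by rewrite -[_ == _]/(k == k0) kk0.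
Qed.

(** There are more vectors than coordinates, so some combination vanishes; its
    sign is chosen to make one coefficient positive. *)
Lemma linear_dependence (R : realFieldType) (I : finType)
    (v : option I -> I -> R) :
  exists2 c : option I -> R,
    (exists k, 0 < c k) & forall i, \sum_k c k * v k i = 0.
Proof.
pose M := \matrix_(a < #|{: option I}|, b < #|I|) v (enum_val a) (enum_val b).
have /rowV0Pn[y yM y0] : kermx M != 0.
  rewrite -mxrank_eq0 mxrank_ker -lt0n subn_gt0.
  by rewrite (leq_ltn_trans (rank_leq_col _))// card_option.
pose d k := y 0 (enum_rank k).
have dv i : \sum_k d k * v k i = 0.
  have /matrixP/(_ 0 (enum_rank i)) := sub_kermxP yM.
  rewrite !mxE => yMi; rewrite -[RHS]yMi (reindex (@enum_val _ {: option I}))/=.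
    by apply: eq_bigr => a _; rewrite /d mxE !(enum_valK, enum_rankK).
  by exists enum_rank => ? _; rewrite ?enum_valK ?enum_rankK.
have [a ya] : exists a, y 0 a != 0.
  apply/existsP; apply: contraNT y0 => /existsPn h.
  by apply/eqP/rowP => a; rewrite mxE; apply/eqP; have := h a; rewrite negbK.
have [dpos|dneg] := ltP 0 (y 0 a).
  by exists d => //; exists (enum_val a); rewrite /d enum_valK.
exists (fun k => - d k).
  by exists (enum_val a); rewrite /d enum_valK oppr_gt0 lt_neqAle ya.
move=> i; under eq_bigr do rewrite mulNr.
by rewrite sumrN dv oppr0.
Qed.

(** Subtracting a multiple of a linear dependence from the weights leaves the
    combination unchanged; the largest multiple that keeps them nonnegative
    makes one of them vanish. *)
Lemma caratheodory_step (R : realFieldType) (I : finType)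
    (v : option I -> I -> R)
    (w : option I -> R) (w0 : forall k, 0 <= w k) :
  exists w' : option I -> R, [/\ forall k, 0 <= w' k, exists j, w' j = 0 &
    forall i, \sum_k w' k * v k i = \sum_k w k * v k i].
Proof.
have [c [k0 ck0] cv] := linear_dependence v.
have [j cj jmin] := @arg_minP _ _ _ k0 [pred k | 0 < c k]
  (fun k => w k / c k) ck0.
exists (fun k => w k - w j / c j * c k); split=> [k||i].
- rewrite subr_ge0; have [ck|ck] := ltP 0 (c k).
    by rewrite -ler_pdivlMr// jmin.
  by rewrite (le_trans _ (w0 k))// mulr_ge0_le0// divr_ge0// ltW.
- by exists j; rewrite divfK ?subrr// gt_eqF.
- under eq_bigr do rewrite mulrBl -(mulrA (w j / c j)).
  by rewrite sumrB -mulr_sumr cv mulr0 subr0.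
Qed.

(** * Continuity, closedness and compactness *)

Lemma continuous_sum (R : realType) (T : topologicalType) (I : finType)
    (f : I -> T -> R) :
  (forall i, continuous (f i)) -> continuous (fun t => \sum_i f i t).
Proof. by move=> cf; apply: continuous_big => //; exact: add_continuous. Qed.

Lemma closed_continuous_le (R : realType) (T : topologicalType) (f g : T -> R) :
  continuous f -> continuous g -> closed [set t | f t <= g t].
Proof.
move=> cf cg.
rewrite (_ : mkset _ = (fun t => f t - g t) @^-1` [set r | r <= 0]).
  apply: (closed_comp _ (@closed_le _ _)) => t _.
  by apply: continuousB; [exact: cf|exact: cg].
by apply/seteqP; split => t /=; rewrite subr_le0.
Qed.

Lemma closed_continuous_eq (R : realType) (T : topologicalType) (f : T -> R)
    (r : R) :
  continuous f -> closed [set t | f t = r].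
Proof.
by move=> cf; apply: (closed_comp _ (@closed_eq _ r)) => t _; exact: cf.
Qed.

Lemma compact_ptws (I : eqType) (T : topologicalType) :
  compact [set: T] -> compact [set: {ptws I -> T}].
Proof.
move=> cT; rewrite (_ : setT = [set f : {ptws I -> T} | forall i, setT (f i)]).
  exact: (@tychonoff I (fun=> T) (fun=> setT)).
by apply/seteqP; split.
Qed.

Lemma ptws_eval_continuous (I : eqType) (T : topologicalType) (i : I) :
  continuous (fun f : {ptws I -> T} => f i).
Proof. exact: (@proj_continuous I (fun=> T) i). Qed.

(** * The topology of the simplex *)

Section belief_topology.
Context (R : realType) (X : finType) (X0 : (0 < #|X|)%N).
Local Notation Delta := (belief R X X0).

Lemma belief_ge0 (nu : Delta) x : 0 <= nu x.
Proof.
by have [nu0 _] := set_valP (nu : set_type (simplex R X)); exact: nu0.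
Qed.

Lemma belief_sum1 (nu : Delta) : \sum_x nu x = 1.
Proof.
by have [_ nu1] := set_valP (nu : set_type (simplex R X)); exact: nu1.
Qed.

Lemma open_belief_preimage (U : set {ptws X -> R}) :
  open U -> open ((@belief_val R X X0 : Delta -> {ptws X -> R}) @^-1` U).
Proof. by move=> oU; exists U. Qed.

Lemma belief_continuous (x : X) : continuous (fun nu : Delta => nu x).
Proof.
apply/continuousP => A oA.
apply: (@open_belief_preimage ((fun f : {ptws X -> R} => f x) @^-1` A)).
apply: open_comp oA => f _; exact: ptws_eval_continuous.
Qed.

(** A closed subset of the cube [[0, 1]^X]. *)
Lemma compact_simplex : compact (simplex R X).
Proof.
pose cube := [set f : {ptws X -> R} | forall x, `[0 : R, 1]%classic (f x)].
have ccube : compact cube.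
  exact: (@tychonoff X (fun=> R) (fun=> `[0 : R, 1]%classic)
    (fun=> @segment_compact R 0 1)).
apply: (subclosed_compact _ ccube) => [|p [p0 p1] x].
  rewrite (_ : simplex R X =
    \bigcap_(x in [set: X]) [set p : {ptws X -> R} | 0 <= p x] `&`
    [set p : {ptws X -> R} | \sum_x p x = 1]).
    apply: closedI.
      apply: closed_bigI => x _; apply: closed_continuous_le.
        exact: cst_continuous.
      exact: ptws_eval_continuous.
    apply: closed_continuous_eq; apply: continuous_sum => x.
    exact: ptws_eval_continuous.
  apply/seteqP; split => p [p0 p1]; split => //= x; last exact: p0.
  by move=> _; exact: p0.
rewrite /= in_itv /= p0 /= -p1 (bigD1 x) //= lerDl.
by apply: sumr_ge0.
Qed.

(** Compactness passes from the simplex, a subset of the function space, to the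
    subtype: a filter on beliefs clusters where its image does. *)
Lemma compact_belief : compact [set: Delta].
Proof.
move=> F PF _; pose val : Delta -> {ptws X -> R} := @belief_val R X X0.
have [|p [pS pF]] := @compact_simplex (val @ F).
  apply: (@filterS _ F _ setT) => [nu _|]; last exact: filterT.
  by split=> [x|]; [exact: belief_ge0|exact: belief_sum1].
exists (SigSub (mem_set pS)); split => // U V FU [_ [[W oW <-] Wp] WV].
have [_ [[nu Unu <-] Wnu]] : (val @` U) `&` W !=set0.
  apply: pF; first by apply: (@filterS _ F _ U _ _ FU) => nu Unu; exists nu.
  exact: open_nbhs_nbhs.
by exists nu; split => //; exact: WV.
Qed.

Lemma belief_accessible : accessible_space Delta.
Proof.
move=> /= nu nu' /eqP nunu'.
have [x nux] : exists x, belief_val nu x <> belief_val nu' x.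
  apply/existsNP => h; apply: nunu'; apply: val_inj.
  exact: funext.
exists ((fun nu : Delta => nu x) @^-1` [set r | r != belief_val nu' x]); split.
- apply: open_comp; last exact: open_neq.
  by move=> ? _; exact: belief_continuous.
- by rewrite inE; apply/eqP.
- by rewrite inE /= eqxx.
Qed.

End belief_topology.

(** * Finitely supported mixtures and their moments *)

Section mixtures.
Context (R : realType) (I : finType) (I0 : (0 < #|I|)%N) (T : topologicalType).

(* A mixture is a family of weights, as a point of the simplex over [I], and a
   family of atoms, possibly repeated. *)
Local Notation mixture := (belief R I I0 * {ptws I -> T})%type.

Definition mean (c : mixture) (g : T -> R) : R := \sum_k c.1 k * g (c.2 k).

Lemma mean_continuous (g : T -> R) :
  continuous g -> continuous (mean ^~ g).
Proof.
move=> cg; apply: continuous_sum => k.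
have c1 : continuous (fun c : mixture => c.1 k).
  move=> c; apply: (@cvg_comp _ _ _ fst (fun nu : belief R I I0 => nu k)).
    exact: cvg_fst.
  exact: belief_continuous.
have c2 : continuous (fun c : mixture => g (c.2 k)).
  move=> c; apply: (@cvg_comp _ _ _ snd (fun f : {ptws I -> T} => g (f k))).
    exact: cvg_snd.
  apply: (@cvg_comp _ _ _ (fun f : {ptws I -> T} => f k) g).
    exact: ptws_eval_continuous.
  exact: cg.
by move=> c; apply: cvgM; [exact: c1|exact: c2].
Qed.

Lemma compact_mixture : compact [set: T] -> compact [set: mixture].
Proof.
move=> cT; rewrite -setXTT; apply: compact_setX; first exact: compact_belief.
exact: compact_ptws.
Qed.

Section moments.
(* By [g1] a combination of the moments is the total mass: this saves one atom,
   since preserving the moments already preserves the mass. *)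
Variables (g : I -> T -> R) (a : I -> R).
Hypothesis g1 : forall t, \sum_i a i * g i t = 1.

(** Adding the atom [t] with weight [s] yields one atom too many, which
    [caratheodory_step] removes without changing the moments.  This is the only
    form of convexity of the set of moment vectors that is used below. *)
Lemma mean_segment (c : mixture) (t : T) (s : R) : 0 <= s <= 1 ->
  exists c', forall i, mean c' (g i) = (1 - s) * mean c (g i) + s * g i t.
Proof.
move=> /andP[s0 s1].
pose p (o : option I) := if o is Some k then c.2 k else t.
pose w (o : option I) := if o is Some k then (1 - s) * c.1 k else s.
have w0 o : 0 <= w o.
  by case: o => //= k; rewrite mulr_ge0 ?subr_ge0 ?belief_ge0.
have wE i : \sum_o w o * g i (p o) = (1 - s) * mean c (g i) + s * g i t.
  rewrite big_option addrC mulr_sumr; congr (_ + _).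
  by apply: eq_bigr => k _; rewrite /= mulrA.
have [w' [w'0 [j w'j] w'E]] := caratheodory_step (fun o i => g i (p o)) w0.
(* The total mass of any weights is the combination [a] of the moments. *)
have mass (z : option I -> R) :
    \sum_o z o = \sum_i a i * \sum_o z o * g i (p o).
  under [RHS]eq_bigr do rewrite mulr_sumr.
  rewrite exchange_big; apply: eq_bigr => o _ /=.
  by under eq_bigr do rewrite mulrCA; rewrite -mulr_sumr g1 mulr1.
have w'1 : \sum_k w' (avoid j k) = 1.
  rewrite sum_avoid// mass; under eq_bigr do rewrite w'E.
  rewrite -mass big_option /= -mulr_sumr belief_sum1 mulr1; ring.
have w's : simplex R I (fun k => w' (avoid j k)) by split.
exists (SigSub (mem_set w's) : belief R I I0, fun k => p (avoid j k)) => i.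
rewrite -wE -w'E.
by rewrite -(sum_avoid (j := j) (f := fun o => w' o * g i (p o))) ?w'j ?mul0r.
Qed.

(** A vector satisfying every linear inequality valid at all points of [T] lies
    in the closed convex hull of the values of [g].  The mixture whose moments
    are nearest to it realises it: the inequality normal to the difference,
    which holds at every point by minimality, would otherwise be violated. *)
Lemma moments_attained (m : I -> R) (t0 : T) :
    compact [set: T] -> (forall i, continuous (g i)) ->
    (forall (l : I -> R) b, (forall t, \sum_i l i * g i t <= b) ->
       \sum_i l i * m i <= b) ->
  exists c, forall i, mean c (g i) = m i.
Proof.
move=> cT cg hm.
pose phi c := \sum_i (m i - mean c (g i)) ^+ 2.
have cphi : continuous phi.
  apply: continuous_sum => i; rewrite /continuous_at => c.
  apply: (@continuous_comp _ _ _ (fun c => m i - mean c (g i))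
    (fun r => r ^+ 2)).
    apply: continuousB; first exact: cst_continuous.
    exact: mean_continuous.
  exact: exprn_continuous.
have [|c _ cmin] := compact_EVT_min _ (compact_mixture cT)
  (continuous_subspaceT cphi).
  by exists (belief_point R I0, fun=> t0).
exists c.
pose l i := m i - mean c (g i).
(* First-order optimality of [c] along the segments towards single points. *)
have key t : \sum_i l i * g i t <= \sum_i l i * mean c (g i).
  pose d i := g i t - mean c (g i).
  set A := \sum_i l i * d i.
  pose B := \sum_i d i ^+ 2.
  have B0 : 0 <= B by apply: sumr_ge0 => i _; exact: sqr_ge0.
  suff : A <= 0.
    by rewrite /A; under eq_bigr do rewrite mulrBr; rewrite sumrB subr_le0.
  rewrite leNgt; apply/negP => A0.
  have AB0 : 0 < A + B by rewrite ltr_wpDr.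
  (* A step small enough for the linear decrease [2 * s * A] to exceed the
     quadratic term [s ^+ 2 * B]. *)
  pose s := A / (A + B).
  have s0 : 0 < s by rewrite divr_gt0.
  have s1 : s <= 1 by rewrite ler_pdivrMr// mul1r lerDl.
  have [|c' c'E] := mean_segment c t (s := s); first by rewrite ltW.
  have : phi c <= phi c' by apply: cmin; rewrite inE.
  have -> : phi c' = phi c - 2 * s * A + s ^+ 2 * B.
    rewrite /phi /A /B !mulr_sumr -sumrB -big_split /=.
    by apply: eq_bigr => i _; rewrite c'E /d /l; ring.
  have sAB : s * (A + B) = A by rewrite divfK// gt_eqF.
  have := mulr_gt0 s0 A0; nra.
have := hm l _ key; rewrite -subr_le0 -sumrB.
under eq_bigr do rewrite -mulrBr -expr2.
move=> phi0 i; have : phi c = 0.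
  by apply/le_anti; rewrite phi0 sumr_ge0// => k _; exact: sqr_ge0.
move=> /eqP; rewrite psumr_eq0; last by move=> k _; exact: sqr_ge0.
move=> /allP/(_ i); rewrite mem_index_enum sqrf_eq0 subr_eq0 => /(_ isT)/eqP.
by move=> ->.
Qed.

End moments.
End mixtures.

(** * Expectations of continuous functions of the belief *)

Section belief_expectation.
Context (R : realType) (X : finType) (X0 : (0 < #|X|)%N).
Local Notation Delta := (belief R X X0).
Implicit Types (P : probability Delta R) (g : Delta -> R).

Lemma belief_open_measurable (U : set Delta) : open U -> measurable U.
Proof. by move=> oU; apply: sub_sigma_algebra. Qed.

Lemma belief_measurable_fun g : continuous g -> measurable_fun setT g.
Proof.
move=> /continuousP cg; apply: (measurability _ (RGenOpens.measurableE R)).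
move=> _ [_ [a [b ->] <-]]; rewrite setTI; apply: belief_open_measurable.
exact/cg/interval_open.
Qed.

Lemma belief_integrable P g : continuous g -> P.-integrable setT (EFin \o g).
Proof.
move=> cg; apply: measurable_bounded_integrable => //.
- by rewrite [X in (X < _)%E](@probability_setT _ _ _ P) ltry.
- exact: belief_measurable_fun.
- have /compact_bounded[M [_ hM]] :=
    continuous_compact (continuous_subspaceT cg) (@compact_belief R X X0).
  exists M; split; rewrite ?num_real// => r Mr nu _.
  by apply: hM Mr _ _; exists nu.
Qed.

Lemma expectationE P g : continuous g -> 'E_P[g]%E = (\int[P]_nu g nu)%:E.
Proof.
move=> cg; rewrite unlock /Rintegral fineK//.
exact: integrable_fin_num (belief_integrable P cg).
Qed.

Lemma Rintegral_sum P (I : finType) (g : I -> Delta -> R) :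
  (forall i, continuous (g i)) ->
  \int[P]_nu (\sum_i g i nu) = \sum_i \int[P]_nu g i nu.
Proof.
move=> cg; apply: EFin_inj; rewrite -sumEFin.
rewrite -expectationE; last exact: continuous_sum.
rewrite unlock; under eq_integral do rewrite -sumEFin.
rewrite integral_sum//; last by move=> i; exact: belief_integrable.
by apply: eq_bigr => i _; rewrite -expectationE// unlock.
Qed.

(** The moments of [P] meet the hypothesis of [moments_attained]: since [P] has
    mass [1], a linear bound valid at every belief survives integration. *)
Lemma Rintegral_linear_le P (I : finType) (g : I -> Delta -> R) (l : I -> R) b :
  (forall i, continuous (g i)) -> (forall nu, \sum_i l i * g i nu <= b) ->
  \sum_i l i * \int[P]_nu g i nu <= b.
Proof.
move=> cg gb.
have clg i : continuous (fun nu => l i * g i nu).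
  by move=> nu; apply: continuousM; [exact: cst_continuous|exact: cg].
under eq_bigr => i _.
  rewrite -(RintegralZl _ measurableT (belief_integrable P (cg i))).
  over.
rewrite -Rintegral_sum//.
have <- : \int[P]_nu b = b.
  by rewrite Rintegral_cst// [X in fine X]probability_setT mulr1.
apply: le_Rintegral => //.
- by apply: belief_integrable; exact: continuous_sum.
- by apply: belief_integrable; exact: cst_continuous.
Qed.

(** * The probability measure of a mixture *)

Section atomic.
Context (I : finType) (I0 : (0 < #|I|)%N).
Variable c : belief R I I0 * {ptws I -> Delta}.

Let k0 : I := enum_val (Ordinal I0).

Let sum_nth (V : nmodType) (f : I -> V) :
  \sum_(n < #|I|) f (nth k0 (enum I) n) = \sum_k f k.
Proof.
transitivity (\sum_(k <- enum I) f k); last by rewrite big_enum.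
by rewrite (big_nth k0) -cardE big_mkord.
Qed.

(* Finite sums of measures are indexed by [nat]: the elements of [I] are
   numbered by their position in [enum I], with default [k0] beyond it. *)
Let atom (n : nat) : {measure set Delta -> \bar R} :=
  mscale (NngNum (belief_ge0 c.1 (nth k0 (enum I) n)))
    \d_(c.2 (nth k0 (enum I) n)).

Definition atomic : set Delta -> \bar R := msum atom #|I|.

HB.instance Definition _ := Measure.on atomic.

Let atomicE (U : set Delta) :
  atomic U = (\sum_k (c.1 k)%:E * \d_(c.2 k) U)%E.
Proof. by rewrite /atomic /msum -sum_nth. Qed.

Let atomic_setT : atomic setT = 1%E.
Proof.
rewrite atomicE; under eq_bigr do rewrite diracT mule1.
by rewrite sumEFin belief_sum1.
Qed.

HB.instance Definition _ :=
  Measure_isProbability.Build _ _ _ atomic atomic_setT.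

Let ge0_integral_atomic (g : Delta -> R) :
    measurable_fun setT g -> (forall nu, 0 <= g nu) ->
  (\int[atomic]_nu (g nu)%:E)%E = (mean c g)%:E.
Proof.
move=> mg g0; rewrite ge0_integral_measure_sum//; last first.
- exact/measurable_EFinP.
- by move=> nu _; rewrite lee_fin.
rewrite /mean -sum_nth -sumEFin; apply: eq_bigr => n _.
rewrite ge0_integral_mscale//; last first.
- by move=> nu _; rewrite lee_fin.
- exact/measurable_EFinP.
rewrite integral_dirac//; last exact/measurable_EFinP.
by rewrite diracT mul1e EFinM.
Qed.

(** The integral of a sum of measures is additive for nonnegative functions;
    the positive and negative parts of [g] are treated separately. *)
Lemma expectation_atomic (g : Delta -> R) : continuous g ->
  'E_atomic[g]%E = (mean c g)%:E.
Proof.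
move=> /belief_measurable_fun mg; rewrite unlock integralE.
rewrite -[X in (X^\+)%E]/(EFin \o g) -[X in (X^\-)%E]/(EFin \o g).
rewrite funerpos funerneg !ge0_integral_atomic//.
- rewrite -EFinB /mean -sumrB; congr (_%:E); apply: eq_bigr => k _.
  rewrite -mulrBr; congr (_ * _).
  exact: (congr1 (fun h => h (c.2 k)) (funrposBneg g)).
- exact: measurable_funrneg.
- exact: measurable_funrpos.
Qed.

(** The atoms form a finite, hence closed, set whose complement has measure
    zero. *)
Lemma supp_atomic : supp atomic `<=` range c.2.
Proof.
move=> nu nusupp; apply: contrapT => nunot.
have oC : open (~` range c.2).
  rewrite openC.
  have /accessible_finite_set_closed := @belief_accessible R X X0; apply.
  exact: finite_image.
have := nusupp _ oC nunot; rewrite [X in (_ < X)%E]atomicE big1 ?ltxx//.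
move=> k _; rewrite diracE memNset ?mule0//= => nk.
by apply: nk; exists k.
Qed.

Lemma card_supp_atomic : supp atomic #<= `I_#|I|.
Proof.
have supp_nth : supp atomic `<=`
    (fun n => c.2 (nth k0 (enum I) n)) @` `I_#|I|.
  move=> _ /supp_atomic[k _ <-]; exists (index k (enum I)).
    by rewrite /= cardE index_mem mem_enum.
  by rewrite nth_index ?mem_enum.
exact: card_le_trans (subset_card_le supp_nth) (card_image_le _ _).
Qed.

End atomic.
End belief_expectation.

(** * Optimal profiles of mixtures *)

(** Caratheodory's theorem for barycenters: the moments of any probability
    measure are those of a mixture with as many atoms as moments. *)
Lemma expectation_mean (R : realType) (X : finType) (X0 : (0 < #|X|)%N)
    (I : finType) (I0 : (0 < #|I|)%N) (g : I -> belief R X X0 -> R)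
    (a : I -> R) (P : probability (belief R X X0) R) :
  (forall nu, \sum_i a i * g i nu = 1) -> (forall i, continuous (g i)) ->
  exists c : belief R I I0 * {ptws I -> belief R X X0},
    forall i, 'E_P[g i]%E = (mean c (g i))%:E.
Proof.
move=> g1 cg.
have [c cE] := moments_attained I0 g1 (belief_point R X0)
  (@compact_belief R X X0) cg
  (fun l b => @Rintegral_linear_le _ _ _ P _ g l b cg).
by exists c => i; rewrite expectationE// cE.
Qed.

Section atomic_persuasion.
Context (R : realType) (X : finType) (X0 : (0 < #|X|)%N) (N : nat).
Local Notation Delta := (belief R X X0).
Variables (pi : 'I_N -> R) (V F : 'I_N -> Delta -> R) (mu : Delta).
Hypotheses (hV : forall i, continuous (V i)) (hF : forall i, continuous (F i)).

(** Labels of the moments on which type [i]'s distribution matters, and at the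
    same time labels of the atoms. *)
Definition moment_index : finType := option ('I_N + X).

Lemma card_moment_index : #|moment_index| = (N + #|X|).+1.
Proof. by rewrite card_option card_sum card_ord. Qed.

Lemma moment_index_gt0 : (0 < #|moment_index|)%N.
Proof. by rewrite card_moment_index. Qed.

Definition moment (i : 'I_N) (o : moment_index) : Delta -> R :=
  match o with
  | None => V i
  | Some (inl j) => F j
  | Some (inr x) => fun nu => nu x
  end.

Lemma moment_continuous i o : continuous (moment i o).
Proof. by case: o => [[j|x]|] //=; exact: belief_continuous. Qed.

Lemma moment_affine1 i nu :
  \sum_o (if o is Some (inr _) then 1 else 0) * moment i o nu = 1.
Proof.
rewrite big_option mul0r add0r big_sumType /= big1 ?add0r => [|j _].
  by under eq_bigr do rewrite mul1r; exact: belief_sum1.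
by rewrite mul0r.
Qed.

Local Notation mixture :=
  (belief R moment_index moment_index_gt0 * {ptws moment_index -> Delta})%type.
Local Notation menu := {ptws 'I_N -> mixture}.

Definition atomic_profile (q : menu) (i : 'I_N) : probability Delta R :=
  atomic (q i).

Definition feasible_menu : set menu :=
  [set q | (forall i j, mean (q j) (F i) <= mean (q i) (F i)) /\
           forall i x, mean (q i) (fun nu : Delta => nu x) = mu x].

Lemma feasible_atomic_profile q :
  feasible_menu q -> feasible F mu (atomic_profile q).
Proof.
move=> [qIC qmu]; split=> [i j|i x].
  by rewrite /atomic_profile !expectation_atomic// lee_fin.
rewrite /atomic_profile expectation_atomic ?qmu//.
exact: belief_continuous.
Qed.

Lemma objective_atomic_profile q :
  objective pi V (atomic_profile q) = (\sum_i pi i * mean (q i) (V i))%:E.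
Proof.
rewrite /objective -sumEFin; apply: eq_bigr => i _.
by rewrite /atomic_profile expectation_atomic.
Qed.

(** Replacing each [P i] by a mixture with the same moments loses neither
    feasibility nor value, so optimising over mixtures is enough. *)
Lemma feasible_reduction (P : 'I_N -> probability Delta R) :
  feasible F mu P ->
  exists2 q, feasible_menu q &
    objective pi V P = (\sum_i pi i * mean (q i) (V i))%:E.
Proof.
move=> [PIC Pmu].
have /choice[q qE] i := expectation_mean moment_index_gt0 (P i)
  (moment_affine1 i) (@moment_continuous i).
exists q.
  split=> [i j|i x].
    have := PIC i j.
    by rewrite (qE i (Some (inl i))) (qE j (Some (inl i))) lee_fin.
  by apply: EFin_inj; rewrite -(qE i (Some (inr x))) Pmu.
rewrite /objective -sumEFin; apply: eq_bigr => i _.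
by rewrite (qE i None).
Qed.

Lemma menu_mean_continuous i (g : Delta -> R) :
  continuous g -> continuous (fun q : menu => mean (q i) g).
Proof.
move=> cg q; apply: (@cvg_comp _ _ _ (fun q : menu => q i)
    (fun c : mixture => mean c g)).
  exact: ptws_eval_continuous.
exact: mean_continuous.
Qed.

Lemma compact_feasible_menu : compact feasible_menu.
Proof.
have cmenu : compact [set: menu].
  by apply: compact_ptws; apply: compact_mixture; exact: compact_belief.
apply: (subclosed_compact _ cmenu) => //.
rewrite (_ : feasible_menu =
  (\bigcap_(i in setT) \bigcap_(j in setT)
     [set q : menu | mean (q j) (F i) <= mean (q i) (F i)]) `&`
  (\bigcap_(i in setT) \bigcap_(x in setT)
     [set q : menu | mean (q i) (fun nu : Delta => nu x) = mu x])).
  apply: closedI; apply: closed_bigI => i _; apply: closed_bigI => j _.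
    by apply: closed_continuous_le; exact: menu_mean_continuous.
  apply: closed_continuous_eq; apply: menu_mean_continuous.
  exact: belief_continuous.
apply/seteqP; split => [q [qIC qmu]|q [qIC qmu]]; split => i.
- by move=> _ j _; exact: qIC.
- by move=> _ x _; exact: qmu.
- by move=> j; exact: qIC.
- by move=> x; exact: qmu.
Qed.

(** Revealing nothing, that is the point mass at [mu] for every type. *)
Lemma feasible_menu_neq0 : feasible_menu !=set0.
Proof.
exists (fun=> (belief_point R moment_index_gt0, fun=> mu)).
split=> [//|i x].
by rewrite /mean /= -mulr_suml belief_sum1 mul1r.
Qed.

Lemma optimal_menu : exists2 q, feasible_menu q &
  forall q', feasible_menu q' ->
    \sum_i pi i * mean (q' i) (V i) <= \sum_i pi i * mean (q i) (V i).
Proof.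
have cobj : continuous (fun q : menu => \sum_i pi i * mean (q i) (V i)).
  apply: continuous_sum => i q; apply: continuousM; first exact: cst_continuous.
  exact: menu_mean_continuous.
have [q /set_mem qS qmax] := compact_EVT_max feasible_menu_neq0
  compact_feasible_menu (continuous_subspaceT cobj).
by exists q => // q' q'S; exact: (qmax q' (mem_set q'S)).
Qed.

End atomic_persuasion.

Theorem proposition4 (R : realType) (X : finType) (X0 : (0 < #|X|)%N)
    (N : nat) (pi : 'I_N -> R) (hpi : simplex R 'I_N pi)
    (A : Type) (u : A -> X -> 'I_N -> R)
    (V F : 'I_N -> belief R X X0 -> R)
    (hV : forall i, continuous (V i))
    (hF : forall i, continuous (F i))
    (hFmax : forall i nu, is_max (range (exp_utility u i nu)) (F i nu))
    (mu : belief R X X0) :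
  exists P : 'I_N -> probability (belief R X X0) R,
    solves (feasible F mu) (objective pi V) P /\
    forall i : 'I_N, supp (P i) #<= `I_((N + 2) * #|X|).
Proof.
have [q qS qmax] := optimal_menu pi mu hV hF.
exists (atomic_profile q); split.
  have qfeas := feasible_atomic_profile hF qS.
  split=> //; apply/le_anti/andP; split.
    by apply: ereal_sup_ubound; exists (atomic_profile q).
  apply: ge_ereal_sup => _ [P /(feasible_reduction pi hV hF)[q' q'S ->] <-].
  by rewrite objective_atomic_profile// lee_fin qmax.
move=> i; apply: card_le_trans (card_supp_atomic _) _.
rewrite card_le_II card_moment_index.
(* [N + |X| + 1 <= (N + 1) * |X| + |X|] since [|X| >= 1]. *)
rewrite (_ : (N + 2) * #|X| = (N + 1) * #|X| + #|X|)%N; last by ring.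
by rewrite -addSn leq_add2r -addn1 leq_pmulr.
Qed.
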